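(* Let $n\ge 2$, let $\mathcal H$ be a real Hilbert space, and let $A_1,\dots,A_n:\mathcal H\rightrightarrows\mathcal H$ be maximal monotone operators such that there exists $x\in\mathcal H$ with $0\in\sum_{i=1}^n A_i(x)$. Let $\phi:\mathbb S^n_+\times\mathbb S^n\to(-\infty,\infty]$ be any proper lower semicontinuous function, and let $\gamma\in(0,1)$, $\mathcal C\subseteq\mathbb S^n_+\times\mathbb S^n$, $c>0$ and $\varepsilon\in[0,2)$. Consider the problem $$\begin{aligned}\text{minimize}_{W,Z}\quad & \phi(W,Z)\\ \text{subject to}\quad & W\mathbb 1=0,\\ & \lambda_1(W)+\lambda_2(W)\ge c,\\ & Z-W\succeq 0,\\ & \mathbb 1^TZ\mathbb 1=0,\\ & \mathrm{diag}(Z)=Z_{11}\mathbb 1,\\ & 2-\varepsilon\le Z_{11}\le 2+\varepsilon,\\ & (W,Z)\in\mathcal C,\\ & W\in\mathbb S^n_+,\ Z\in\mathbb S^n.\end{aligned}\qquad (\mathrm P)$$ Let $(W,Z)$ be any solution of $(\mathrm P)$, let $L\in\mathbb R^{n\times n}$ be the lower triangular matrix with $Z=2\,\mathrm{Id}-L-L^T$, and let $M\in\mathbb R^{d\times n}$ be any matrix (for any $d$) with $W=M^TM$. Then: (1) For every $\mathbf v^0\in\mathrm{range}(\mathbf M^T)\subseteq\mathcal H^n$, the sequence $(\mathbf x^k)$ in $\mathcal H^n$ generated by $$\mathbf x^k=J_{\mathbf A}(\mathbf v^k+\mathbf L\mathbf x^k),\qquad \mathbf v^{k+1}=\mathbf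 v^k-\gamma\mathbf W\mathbf x^k$$ converges weakly to a vector $(x^*,\dots,x^* )$ all of whose components equal a single $x^*\in\mathcal H$ with $0\in\sum_{i=1}^nA_i(x^* )$. (2) For every $\mathbf z^0\in\mathcal H^d$, the sequence $(\mathbf x^k)$ in $\mathcal H^n$ generated by $$\mathbf x^k=J_{\mathbf A}(-\mathbf M^T\mathbf z^k+\mathbf L\mathbf x^k),\qquad \mathbf z^{k+1}=\mathbf z^k+\gamma\mathbf M\mathbf x^k$$ converges weakly to a vector $(x^*,\dots,x^* )$ all of whose components equal a single $x^*\in\mathcal H$ with $0\in\sum_{i=1}^nA_i(x^* )$. Moreover, if all the operators $A_i$ are $\mu$-strongly monotone for some $\mu>0$, then (1) and (2) hold for every $\gamma\in(0,1+2\mu/\|W\|)$.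
   Context: $\mathbb S^n$ is the set of real symmetric $n\times n$ matrices, $\mathbb S^n_+$ the positive semidefinite ones, $\succeq$ the Loewner order, $\lambda_1(K)\le\dots\le\lambda_n(K)$ the eigenvalues of $K\in\mathbb S^n$ in increasing order, $\mathbb 1$ the all-ones vector, $\mathrm{Id}$ the identity, $\|W\|$ the spectral norm. Bold matrices denote Kronecker lifts: for a real matrix $K$, $\mathbf K=K\otimes\mathrm{Id}$ acts on tuples of elements of $\mathcal H$, and $\mathbf K^T=K^T\otimes\mathrm{Id}$. The operator $\mathbf A:\mathcal H^n\rightrightarrows\mathcal H^n$ acts componentwise, $\mathbf A(x_1,\dots,x_n)=A_1(x_1)\times\dots\times A_n(x_n)$. The resolvent of an operator $A$ is $J_A=(\mathrm{Id}+A)^{-1}$. An operator $A$ is $\mu$-strongly monotone if $\langle x-y,u-v\rangle\ge\mu\|x-y\|^2$ for all $u\in A(x)$, $v\in A(y)$. In each iteration $\mathbf x^k$ is the solution of the displayed fixed-point equation; it can be computed component by component because $L$ is lower triangular and has diagonal entries less than $1$. *)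

(* Defs.v *)
From HB Require Import structures.
From mathcomp Require Import all_boot all_order all_algebra.
From mathcomp Require Import polyrcf.
From mathcomp Require Import all_classical all_reals all_analysis.
From mathcomp Require Import sesquilinear.

Set Implicit Arguments.
Unset Strict Implicit.
Unset Printing Implicit Defensive.

Import Order.TTheory GRing.Theory Num.Theory.
Import numFieldNormedType.Exports.

Local Open Scope classical_set_scope.
Local Open Scope ring_scope.

HB.mixin Record CompleteNormedModule_isHilbert (R : realType) H
    of CompleteNormedModule R H := {
  inner : {dot H for @idfun R};
  inner_norm : forall x : H, inner x x = `|x| ^+ 2
}.

#[short(type="hilbertType")]
HB.structure Definition Hilbert (R : realType) :=
  { H of CompleteNormedModule R H & CompleteNormedModule_isHilbert R H }.

Arguments inner {R} {s}.

Section operators.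
Context {R : realType} {H : hilbertType R}.
Implicit Types A B : H -> set H.

Definition monotone A := forall x y u v,
  A x u -> A y v -> 0 <= inner (x - y) (u - v).

Definition maximal_monotone A :=
  monotone A /\
  forall B, monotone B -> (forall x, A x `<=` B x) -> forall x, B x `<=` A x.

Definition strongly_monotone (mu : R) A := forall x y u v,
  A x u -> A y v -> mu * `|x - y| ^+ 2 <= inner (x - y) (u - v).

Definition sum_op {n} (A : 'I_n -> H -> set H) : H -> set H :=
  fun x => [set \sum_i u i | u in [set u : 'I_n -> H | forall i, A i x (u i)]].

End operators.

Definition inverse_op {U V : Type} (T : U -> set V) : V -> set U :=
  fun y => [set x | T x y].

Definition resolvent {V : zmodType} (T : V -> set V) : V -> set V :=
  inverse_op (fun x => [set x + u | u in T x]).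

Section product_space.
Context {R : realType} {H : hilbertType R}.

Definition product_op {n} (A : 'I_n -> H -> set H) : H ^ n -> set (H ^ n) :=
  fun x => [set u | forall i, A i (x i) (u i)].

Definition kron_lift {m n} (K : 'M[R]_(m, n)) (x : H ^ n) : H ^ m :=
  [ffun i => \sum_j K i j *: x j].

(* The inner product of the Hilbert direct sum. *)
Definition inner_prod {n} (x y : H ^ n) : R := \sum_i inner (x i) (y i).

Definition weakly_cvg {n} (x : nat -> H ^ n) (l : H ^ n) :=
  forall y, inner_prod (x k) y @[k --> \oo] --> inner_prod l y.

End product_space.

Section matrices.
Context {R : realType}.

Definition symmx {n} : set 'M[R]_n := [set K | K^T = K].

Definition psd {n} : set 'M[R]_n :=
  [set K | symmx K /\ forall x : 'cV[R]_n, 0 <= (x^T *m K *m x) 0 0].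

(* [rootsR p] is the increasing list of the distinct real roots of [p], so this
   is the increasing list of the real eigenvalues with algebraic multiplicity;
   it has length n when [K] is symmetric. *)
Definition eigenvalues {n} (K : 'M[R]_n) : seq R :=
  flatten [seq nseq (mup a (char_poly K)) a | a <- rootsR (char_poly K)].

(* The k-th smallest eigenvalue, numbered from k = 1. *)
Definition lambda {n} (k : nat) (K : 'M[R]_n) : R := (eigenvalues K)`_k.-1.

Definition enorm {n} (x : 'cV[R]_n) : R := Num.sqrt (\sum_i x i 0 ^+ 2).

Definition spectral_norm {m n} (K : 'M[R]_(m, n)) : R :=
  sup [set enorm (K *m x) | x in [set x | enorm x <= 1]].

Definition ones {n} : 'cV[R]_n := const_mx 1.

End matrices.

Section problem.
Context {R : realType} {n : nat}.
Implicit Types (phi : 'M[R]_n * 'M[R]_n -> \bar R)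
  (C : set ('M[R]_n * 'M[R]_n)) (W Z : 'M[R]_n).

(* Only the values of the objective on this set are meaningful. *)
Definition objective_domain : set ('M[R]_n * 'M[R]_n) := psd `*` symmx.

Definition proper_objective phi :=
  (forall p, objective_domain p -> (-oo < phi p)%E) /\
  exists2 p, objective_domain p & (phi p < +oo)%E.

(* Lower semicontinuity relative to [objective_domain]: points outside a set
   are isolated in its [subspace] topology and put no constraint on [phi]. *)
Definition lsc_objective phi :=
  lower_semicontinuous (phi : subspace objective_domain -> \bar R).

Definition feasible (hn : (2 <= n)%N) (c eps : R) C W Z :=
  let Z11 := let i1 := Ordinal (ltnW hn) in Z i1 i1 in
  W *m ones = 0 :> 'cV[R]_n /\
  c <= lambda 1 W + lambda 2 W /\
  psd (Z - W) /\
  ones^T *m Z *m ones = 0 :> 'M[R]_1 /\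
  (forall i, Z i i = Z11) /\
  2 - eps <= Z11 <= 2 + eps /\
  C (W, Z) /\
  psd W /\ symmx Z.

Definition solution phi (hn : (2 <= n)%N) (c eps : R) C W Z :=
  feasible hn c eps C W Z /\
  forall W' Z', feasible hn c eps C W' Z' -> (phi (W, Z) <= phi (W', Z'))%E.

End problem.

Section iterations.
Context {R : realType} {H : hilbertType R} {n : nat}.
Variables (A : 'I_n -> H -> set H) (L : 'M[R]_n) (gamma : R).

(* The resolvent is set-valued here, so "x = J_A w" reads "x belongs to J_A w";
   the two agree because resolvents of monotone operators are at most
   single-valued. The bold lift of K to tuples of vectors is [kron_lift K]. *)
Definition iteration_W (W : 'M[R]_n) (v x : nat -> H ^ n) := forall k,
  resolvent (product_op A) (v k + kron_lift L (x k)) (x k) /\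
  v k.+1 = v k - gamma *: kron_lift W (x k).

Definition iteration_M {d} (M : 'M[R]_(d, n)) (z : nat -> H ^ d)
    (x : nat -> H ^ n) := forall k,
  resolvent (product_op A) (- kron_lift M^T (z k) + kron_lift L (x k)) (x k) /\
  z k.+1 = z k + gamma *: kron_lift M (x k).

Definition cvg_to_common_zero (x : nat -> H ^ n) :=
  exists2 xs, sum_op A xs 0 & weakly_cvg x [ffun=> xs].

Definition both_converge (W : 'M[R]_n) {d} (M : 'M[R]_(d, n)) :=
  (forall v x, range (kron_lift M^T) (v 0%N) -> iteration_W W v x ->
     cvg_to_common_zero x) /\
  (forall z x, iteration_M M z x -> cvg_to_common_zero x).

End iterations.

(* Main.v *)
Require Import Defs.
From mathcomp Require Import all_boot all_order all_algebra.
From mathcomp Require Import polyrcf.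
From mathcomp Require Import all_classical all_reals all_analysis.
From mathcomp Require Import sesquilinear ring lra.

Set Implicit Arguments.
Unset Strict Implicit.
Unset Printing Implicit Defensive.

Import Order.TTheory GRing.Theory Num.Theory.
Import numFieldNormedType.Exports.

Local Open Scope classical_set_scope.
Local Open Scope ring_scope.

(** The iteration in [z] is Fejer monotone with respect to its stationary points,
and this together with demiclosedness of the graph of a maximal monotone operator
and Opial's argument gives weak convergence.

The Cholesky factorization [Z - W = T^T T] ([cholesky]) gives
[2 Id - L - L^T = M^T M + T^T T], where [M 1 = 0] and [T 1 = 0]. The bound on the
two smallest eigenvalues forces the kernel of [W], hence of [M], to be spanned by
the all-ones vector ([lambda12_ker]), so that [N M] is the projection onto the
tuples of sum zero for some [N] ([row_factor]).

If [x] solves the resolvent equation for [z], the operator value at [x] is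
[u = - M^T z + L x - x], and [<x, u> = - <M x, z> - (|M x|^2 + |T x|^2) / 2]. For
a stationary pair [(z', x')], which exists as soon as the sum of the operators has
a zero ([exists_fixed_pair]), the same identity for the differences and
monotonicity give
[|z + gamma M x - z'|^2 <= |z - z'|^2 - gamma (1 + 2 kappa - gamma) |M x|^2]
([fejer_step]), with [kappa = 0] for monotone operators and [kappa = mu / |W|] for
strongly monotone ones. Hence the sequence [z] is bounded and [M x] tends to zero
strongly. The sequence [x] is bounded too, because the first row of [L] is zero
off the diagonal and its diagonal entry is less than one, so that the first
component of [x] is a Lipschitz function of [z] ([first_component]), and because
the other components differ from the first one by images of [M x].

Weak sequential compactness is replaced by weak limits along ultrafilters, which
exist for bounded sequences by Riesz representation ([ultra_wcvg]). Since [<x, u>]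
tends to zero, a weak limit of [(z, x)] along any ultrafilter is again a stationary
pair ([weak_limit_fixed]). Two such limits have the same [z]-part, since
[|z - zeta|^2] converges for every stationary [(zeta, xi)], and then the same
[x]-part, since the first component of [xi] is determined by [zeta] and [xi] is a
consensus tuple ([iteration_M_cvg]). The iteration in [v] reduces to the one in
[z] by [v = - M^T z] ([iteration_W_to_M]). *)

(** * The inner product of a Hilbert space *)

Section inner_product.
Context {R : realType} {H : hilbertType R}.
Implicit Types x y z : H.

Lemma innerC x y : inner x y = inner y x.
Proof. by rewrite hermC expr0 mul1r. Qed.

Lemma innerDl x y z : inner (x + y) z = inner x z + inner y z.
Proof. exact: linearDl. Qed.

Lemma innerDr x y z : inner z (x + y) = inner z x + inner z y.
Proof. exact: linearDr. Qed.

Lemma innerNl x z : inner (- x) z = - inner x z.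
Proof. exact: linearNl. Qed.

Lemma innerNr x z : inner z (- x) = - inner z x.
Proof. exact: linearNr. Qed.

Lemma innerZl (a : R) x z : inner (a *: x) z = a * inner x z.
Proof. exact: linearZl_LR. Qed.

Lemma innerZr (a : R) x z : inner z (a *: x) = a * inner z x.
Proof. by rewrite innerC innerZl innerC. Qed.

Lemma inner0l x : inner 0 x = 0 :> R.
Proof. exact: linear0l. Qed.

Lemma inner_suml I (r : seq I) (P : pred I) (F : I -> H) z :
  inner (\sum_(i <- r | P i) F i) z = \sum_(i <- r | P i) inner (F i) z.
Proof. exact: linear_sumlz. Qed.

Lemma inner_sumr I (r : seq I) (P : pred I) (F : I -> H) z :
  inner z (\sum_(i <- r | P i) F i) = \sum_(i <- r | P i) inner z (F i).
Proof. exact: linear_sumr. Qed.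

Lemma inner_ge0 x : 0 <= inner x x.
Proof. by rewrite inner_norm exprn_ge0. Qed.

Lemma inner_eq0 x : (inner x x == 0) = (x == 0).
Proof. by rewrite inner_norm sqrf_eq0 normr_eq0. Qed.

Lemma inner_inj x y : (forall z, inner x z = inner y z) -> x = y.
Proof.
move=> xy; apply/eqP; rewrite -subr_eq0 -inner_eq0.
by rewrite innerDl innerNl xy subrr.
Qed.

Lemma inner_le_norm x y : `|inner x y| <= `|x| * `|y|.
Proof.
have [->|x0] := eqVneq x 0; first by rewrite inner0l !normr0 mul0r.
have x2 : 0 < inner x x by rewrite lt_neqAle eq_sym inner_eq0 x0 inner_ge0.
rewrite -(@ler_pXn2r _ 2) ?nnegrE ?mulr_ge0// exprMn -!inner_norm.
rewrite real_normK ?num_real// -subr_ge0.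
have := inner_ge0 (inner x x *: y - inner x y *: x).
rewrite innerDl !innerDr !innerNl !innerNr !innerZl !innerZr (innerC y x).
set a := inner x x in x2 *; set b := inner x y; set c := inner y y.
rewrite (_ : _ + _ = a * (a * c - b ^+ 2)); last by ring.
by rewrite pmulr_rge0.
Qed.

End inner_product.

(** * Riesz representation and ultrafilters *)

Section weak_topology.
Context {R : realType} {H : hilbertType R}.

Lemma cvg_inner_null T (F : set_system T) {FF : Filter F} (e b : T -> H) (B : R) :
  e t @[t --> F] --> (0 : H) -> (forall t, `|b t| <= B) ->
  inner (e t) (b t) @[t --> F] --> (0 : R).
Proof.
move=> e0 bB; apply/norm_cvg0P.
apply: (@squeeze_cvgr _ _ _ _ (fun=> 0) (fun t => `|e t| * B)).
- apply: nearW => t; rewrite normr_ge0/=.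
  by apply: (le_trans (inner_le_norm _ _)); rewrite ler_wpM2l.
- exact: cvg_cst.
- rewrite -(mul0r B); apply: cvgMr_tmp; exact/norm_cvg0P.
Qed.

Lemma cvg_innerl T (F : set_system T) {FF : Filter F} (x : T -> H) (l y : H) :
  x t @[t --> F] --> l -> inner (x t) y @[t --> F] --> inner l y.
Proof.
move=> xl; apply/subr_cvg0.
under eq_fun do rewrite -innerNl -innerDl.
apply: (@cvg_inner_null _ _ _ _ (fun=> y) `|y|) => //.
by apply/subr_cvg0.
Qed.

End weak_topology.

Section riesz.
Context {R : realType} {H : hilbertType R}.

(** Riesz representation of a bounded linear functional [f]: the minimizing
sequences of [|x|^2 - 2 f(x)] are Cauchy by the parallelogram identity, and the
minimizer represents [f]. *)
Lemma riesz_representation (f : H -> R) (B : R) :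
  (forall a x y, f (a *: x + y) = a * f x + f y) ->
  (forall x, `|f x| <= B * `|x|) ->
  exists l, forall y, f y = inner l y.
Proof.
move=> flin fB.
pose g x := inner x x - 2 * f x.
have f0 : f 0 = 0.
  by have := flin (-1) 0 0; rewrite scaler0 addr0 => ->; rewrite mulN1r addNr.
have fD x y : f (x + y) = f x + f y by have := flin 1 x y; rewrite scale1r mul1r.
have fZ a x : f (a *: x) = a * f x by have := flin a x 0; rewrite !addr0 f0 addr0.
have glb x : - B ^+ 2 <= g x.
  have := fB x; rewrite ler_norml => /andP[_ fx].
  rewrite /g inner_norm; have := sqr_ge0 (`|x| - B); nra.
pose m := inf (range g).
have hasm : has_inf (range g).
  by split; [exists (g 0), 0 | exists (- B ^+ 2) => _ [x _ <-]].
have mle x : m <= g x by apply: ge_inf; [exact: hasm.2 | exists x].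
have par x y : `|x - y| ^+ 2 = 2 * g x + 2 * g y - 4 * g (2^-1 *: (x + y)).
  rewrite -inner_norm /g fZ fD !(innerDl, innerDr, innerNl, innerNr).
  rewrite !(innerZl, innerZr) !(innerDl, innerDr) (innerC y x).
  by field.
have [x xm] : exists x : nat -> H, forall k, g (x k) < m + k.+1%:R^-1.
  suff gk k : exists y, g y < m + k.+1%:R^-1.
    by have [x xm] := choice gk; exists x.
  have [|_ [y _ <-] yk] := @inf_adherent _ (range g) k.+1%:R^-1 _ hasm.
    by rewrite invr_gt0.
  by exists y.
clearbody m.
have xcvg : cvgn x.
  apply/cauchy_cvgP/cauchy_exP => e e0.
  have e20 : 0 < e ^+ 2 / 4 by rewrite divr_gt0 ?exprn_gt0.
  have [N _ Ne] := near_infty_natSinv_lt (PosNum e20).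
  exists (x N); exists N => // k Nk /=; rewrite -ball_normE /=.
  rewrite -(@ltr_pXn2r _ 2) ?nnegrE ?(ltW e0)// par.
  have := mle (2^-1 *: (x N + x k)).
  have NN : N.+1%:R^-1 < e ^+ 2 / 4 := Ne _ (leqnn N).
  have kN : k.+1%:R^-1 < e ^+ 2 / 4 := Ne _ Nk.
  have := xm N; have := xm k; move: NN kN.
  move: (g _) (g _) (g _) (N.+1%:R^-1) (k.+1%:R^-1) (e ^+ 2) => g1 g2 g3 a b E.
  lra.
exists (limn x) => y.
(* compare the infimum with the value at [x k + t y] and let [k] grow *)
have quad t : 0 <= 2 * t * (inner (limn x) y - f y) + t ^+ 2 * inner y y.
  pose h k := k.+1%:R^-1 + 2 * t * (inner (x k) y - f y) + t ^+ 2 * inner y y.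
  apply: (@ler_cvg_to _ \oo _ _ (fun=> 0) h).
  - exact: cvg_cst.
  - apply: cvgD; last exact: cvg_cst.
    rewrite -[X in _ --> X]add0r; apply: cvgD; first exact: cvg_harmonic.
    apply: cvgMl_tmp; apply: cvgB; last exact: cvg_cst.
    exact: cvg_innerl.
  - apply: nearW => k; have := mle (x k + t *: y); have := xm k.
    rewrite /g/h fD fZ !(innerDl, innerDr) !(innerZl, innerZr) (innerC y).
    move: (inner _ _) (inner _ _) (inner _ _) (f _) (f _) (_^-1) => a b c d e r.
    by move=> ? ?; nra.
(* the value [t = - a / (1 + |y|^2)] makes the quadratic polynomial negative
   unless its linear coefficient [2 a] vanishes *)
set a := inner (limn x) y - f y in quad.
suff a0 : a = 0 by apply/esym/eqP; rewrite -subr_eq0 -/a a0.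
have y0 := inner_ge0 y; have := quad (- a / (1 + inner y y)).
rewrite (_ : _ + _ = - (a ^+ 2 * ((2 + inner y y) / (1 + inner y y) ^+ 2))).
  rewrite oppr_ge0 pmulr_lle0.
    by rewrite real_exprn_even_le0 ?num_real//= => /eqP.
  by rewrite divr_gt0 ?exprn_gt0//; lra.
by field; apply/eqP; lra.
Qed.

End riesz.

Section ultrafilters.
Context {R : realType}.

(** Compactness of the segment [[-B, B]]. *)
Lemma ultra_bounded_cvg T (U : set_system T) (a : T -> R) (B : R) :
  UltraFilter U -> (forall t, `|a t| <= B) ->
  exists l : R, a t @[t --> U] --> l.
Proof.
move=> UU aB.
have [|p [_ clp]] := @segment_compact R (- B) B (a @ U) _.
  by apply: (@filterE _ U) => t /=; rewrite in_itv/= -ler_norml.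
exists p => V Vp; have [//|UV] := in_ultra_setVsetC (a @^-1` V) UU.
by have [q [nVq Vq]] := clp (~` V) V UV Vp.
Qed.

(** Convergence along a filter can be tested on the ultrafilters refining it:
otherwise some neighbourhood is missed by a refining ultrafilter. *)
Lemma cvg_ultrafilters T (F : set_system T) {FF : ProperFilter F}
    (Y : topologicalType) (f : T -> Y) (l : Y) :
  (forall U, UltraFilter U -> F `<=` U -> f t @[t --> U] --> l) ->
  f t @[t --> F] --> l.
Proof.
move=> fl V Vl; apply: contrapT => nFV.
have FW : ProperFilter (within (~` (f @^-1` V)) F).
  split; last exact: within_filter.
  rewrite /within/= => F0; apply: nFV; apply: filterS F0 => t /=.
  by move=> nV; apply: contrapT => /nV.
have [U [UU FU]] := ultraFilterLemma FW.
have UV : U (f @^-1` V) by apply: fl Vl => A FA; apply: FU; apply: filterS FA.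
have UnV : U (~` (f @^-1` V)).
  by apply: FU; apply: filterS (@filterT _ F _) => t _ nVt.
by have [t [? ?]] := filter_ex (filterI UV UnV).
Qed.

End ultrafilters.

(** * Tuples of vectors and Kronecker lifts *)

Section tuples.
Context {R : realType} {H : hilbertType R}.

Lemma inner_prodC {n} (x y : H ^ n) : inner_prod x y = inner_prod y x.
Proof. by apply: eq_bigr => i _; rewrite innerC. Qed.

Lemma inner_prodDl {n} (x y z : H ^ n) :
  inner_prod (x + y) z = inner_prod x z + inner_prod y z.
Proof.
by rewrite /inner_prod -big_split; apply: eq_bigr => i _; rewrite ffunE innerDl.
Qed.

Lemma inner_prodDr {n} (x y z : H ^ n) :
  inner_prod z (x + y) = inner_prod z x + inner_prod z y.
Proof. by rewrite !(inner_prodC z) inner_prodDl. Qed.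

Lemma inner_prodZl {n} (a : R) (x z : H ^ n) :
  inner_prod (a *: x) z = a * inner_prod x z.
Proof.
by rewrite /inner_prod mulr_sumr; apply: eq_bigr => i _; rewrite ffunE innerZl.
Qed.

Lemma inner_prodZr {n} (a : R) (x z : H ^ n) :
  inner_prod z (a *: x) = a * inner_prod z x.
Proof. by rewrite !(inner_prodC z) inner_prodZl. Qed.

Lemma inner_prodNl {n} (x z : H ^ n) : inner_prod (- x) z = - inner_prod x z.
Proof. by rewrite -scaleN1r inner_prodZl mulN1r. Qed.

Lemma inner_prodNr {n} (x z : H ^ n) : inner_prod z (- x) = - inner_prod z x.
Proof. by rewrite !(inner_prodC z) inner_prodNl. Qed.

Lemma inner_prod0l {n} (x : H ^ n) : inner_prod 0 x = 0.
Proof. by rewrite -(scale0r (0 : H ^ n)) inner_prodZl mul0r. Qed.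

Lemma inner_prod0r {n} (x : H ^ n) : inner_prod x 0 = 0.
Proof. by rewrite inner_prodC inner_prod0l. Qed.

Lemma inner_prod_ge0 {n} (x : H ^ n) : 0 <= inner_prod x x.
Proof. by apply: sumr_ge0 => i _; exact: inner_ge0. Qed.

Lemma norm_le_inner_prod {n} (x : H ^ n) i : `|x i| ^+ 2 <= inner_prod x x.
Proof.
rewrite /inner_prod (bigD1 i)//= inner_norm lerDl.
by apply: sumr_ge0 => j _; exact: inner_ge0.
Qed.

Lemma inner_prod_eq0 {n} (x : H ^ n) : inner_prod x x = 0 -> x = 0.
Proof.
move=> x0; apply/ffunP => i; rewrite ffunE; apply/eqP.
rewrite -normr_eq0 -sqrf_eq0 eq_le sqr_ge0 andbT -x0; exact: norm_le_inner_prod.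
Qed.

Lemma inner_prod_inj {n} (x y : H ^ n) :
  (forall z, inner_prod x z = inner_prod y z) -> x = y.
Proof.
move=> xy; apply/eqP; rewrite -subr_eq0; apply/eqP; apply: inner_prod_eq0.
by rewrite inner_prodDl inner_prodNl xy subrr.
Qed.

Lemma kron_liftD {m n} (K : 'M[R]_(m, n)) (x y : H ^ n) :
  kron_lift K (x + y) = kron_lift K x + kron_lift K y.
Proof.
apply/ffunP => i; rewrite !ffunE -big_split; apply: eq_bigr => j _.
by rewrite ffunE scalerDr.
Qed.

Lemma kron_liftZ {m n} (K : 'M[R]_(m, n)) a (x : H ^ n) :
  kron_lift K (a *: x) = a *: kron_lift K x.
Proof.
apply/ffunP => i; rewrite !ffunE scaler_sumr; apply: eq_bigr => j _.
by rewrite ffunE !scalerA mulrC.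
Qed.

Lemma kron_lift0 {m n} (K : 'M[R]_(m, n)) : kron_lift K 0 = 0 :> H ^ m.
Proof. by rewrite -(scale0r (0 : H ^ n)) kron_liftZ !scale0r. Qed.

Lemma kron_liftN {m n} (K : 'M[R]_(m, n)) (x : H ^ n) :
  kron_lift K (- x) = - kron_lift K x.
Proof. by rewrite -(scaleN1r x) kron_liftZ scaleN1r. Qed.

Lemma kron_liftB {m p} (K : 'M[R]_(m, p)) (x y : H ^ p) :
  kron_lift K (x - y) = kron_lift K x - kron_lift K y.
Proof. by rewrite kron_liftD kron_liftN. Qed.

Lemma kron_lift_addmx {m n} (K K' : 'M[R]_(m, n)) (x : H ^ n) :
  kron_lift (K + K') x = kron_lift K x + kron_lift K' x.
Proof.
apply/ffunP => i; rewrite !ffunE -big_split; apply: eq_bigr => j _.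
by rewrite mxE scalerDl.
Qed.

Lemma kron_lift_scalemx {m n} (a : R) (K : 'M[R]_(m, n)) (x : H ^ n) :
  kron_lift (a *: K) x = a *: kron_lift K x.
Proof.
apply/ffunP => i; rewrite !ffunE scaler_sumr; apply: eq_bigr => j _.
by rewrite mxE scalerA.
Qed.

Lemma kron_lift_oppmx {m n} (K : 'M[R]_(m, n)) (x : H ^ n) :
  kron_lift (- K) x = - kron_lift K x.
Proof. by rewrite -(scaleN1r K) kron_lift_scalemx scaleN1r. Qed.

Lemma kron_lift_mulmx {m n p} (K : 'M[R]_(m, n)) (K' : 'M[R]_(n, p)) (x : H ^ p) :
  kron_lift (K *m K') x = kron_lift K (kron_lift K' x).
Proof.
apply/ffunP => i; rewrite !ffunE.
under eq_bigr do rewrite mxE scaler_suml.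
rewrite exchange_big/=; apply: eq_bigr => j _.
rewrite ffunE scaler_sumr; apply: eq_bigr => k _.
by rewrite scalerA.
Qed.

Lemma kron_lift_scalar_mx {n} (a : R) (x : H ^ n) : kron_lift a%:M x = a *: x.
Proof.
apply/ffunP => i; rewrite !ffunE (bigD1 i)//= mxE eqxx mulr1n big1 ?addr0//.
by move=> j ji; rewrite mxE eq_sym (negbTE ji) mulr0n scale0r.
Qed.

Lemma kron_lift_adjoint {m n} (K : 'M[R]_(m, n)) (x : H ^ n) (y : H ^ m) :
  inner_prod (kron_lift K x) y = inner_prod x (kron_lift K^T y).
Proof.
rewrite /inner_prod.
under eq_bigr do rewrite ffunE inner_suml.
rewrite exchange_big/=; apply: eq_bigr => j _.
rewrite ffunE inner_sumr; apply: eq_bigr => i _.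
by rewrite innerZl innerZr mxE.
Qed.

(** Weak convergence along an arbitrary filter, for the inner product of the
Hilbert direct sum; for [F = \oo] it is [weakly_cvg]. *)
Definition wcvg {n T} (F : set_system T) (x : T -> H ^ n) (l : H ^ n) :=
  forall y, inner_prod (x t) y @[t --> F] --> inner_prod l y.

(** Boundedness of a family of tuples, uniform in the component. *)
Definition bounded_tuples {n T} (x : T -> H ^ n) :=
  exists B : R, forall t i, `|x t i| <= B.

(** Strong convergence to zero, stated componentwise. *)
Definition null_tuples {n T} (F : set_system T) (x : T -> H ^ n) :=
  forall i, x t i @[t --> F] --> (0 : H).

Section filter.
Context {T : Type} (F : set_system T) {FF : ProperFilter F}.

Lemma wcvgD {n} (x y : T -> H ^ n) l l' :
  wcvg F x l -> wcvg F y l' -> wcvg F (fun t => x t + y t) (l + l').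
Proof.
move=> xl yl z; under eq_fun do rewrite inner_prodDl.
by rewrite inner_prodDl; exact: cvgD.
Qed.

Lemma wcvgN {n} (x : T -> H ^ n) l :
  wcvg F x l -> wcvg F (fun t => - x t) (- l).
Proof.
move=> xl z; under eq_fun do rewrite inner_prodNl.
by rewrite inner_prodNl; exact: cvgN.
Qed.

Lemma wcvg_kron_lift {m n} (K : 'M[R]_(m, n)) (x : T -> H ^ n) l :
  wcvg F x l -> wcvg F (fun t => kron_lift K (x t)) (kron_lift K l).
Proof.
move=> xl z; under eq_fun do rewrite kron_lift_adjoint.
by rewrite kron_lift_adjoint; exact: xl.
Qed.

Lemma wcvg_unique {n} (x : T -> H ^ n) l l' :
  wcvg F x l -> wcvg F x l' -> l = l'.
Proof.
move=> xl xl'; apply: inner_prod_inj => z.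
exact: (cvg_unique _ (xl z) (xl' z)).
Qed.

Lemma null_kron_lift {m n} (K : 'M[R]_(m, n)) (e : T -> H ^ n) :
  null_tuples F e -> null_tuples F (fun t => kron_lift K (e t)).
Proof.
move=> e0 i; under eq_fun do rewrite ffunE.
have s0 : \sum_(j < n) K i j *: (0 : H) = 0.
  by rewrite big1// => j _; rewrite scaler0.
suff : \sum_(j < n) K i j *: e t j @[t --> F] --> \sum_(j < n) K i j *: (0 : H).
  by rewrite s0.
apply: cvg_big => [|j _]; first exact: add_continuous.
by apply: cvgZl_tmp; exact: e0.
Qed.

Lemma inner_prod_null_bounded {n} (e b : T -> H ^ n) :
  null_tuples F e -> bounded_tuples b ->
  inner_prod (e t) (b t) @[t --> F] --> (0 : R).
Proof.
move=> e0 [B bB]; rewrite /inner_prod.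
have s0 : \sum_(j < n) (0 : R) = 0 by rewrite big1.
suff : \sum_i inner (e t i) (b t i) @[t --> F] --> \sum_(j < n) (0 : R).
  by rewrite s0.
apply: cvg_big => [|j _]; first exact: add_continuous.
by apply: (cvg_inner_null (B := B)) => //; exact: e0.
Qed.

Lemma null_wcvg {n} (e : T -> H ^ n) : null_tuples F e -> wcvg F e 0.
Proof.
move=> e0 y; rewrite inner_prod0l.
apply: (@inner_prod_null_bounded _ e (fun=> y)) => //.
by exists (\sum_i `|y i|) => _ i; rewrite (bigD1 i)//= lerDl sumr_ge0.
Qed.

End filter.

Lemma bounded_kron_lift {m n T} (K : 'M[R]_(m, n)) (x : T -> H ^ n) :
  bounded_tuples x -> bounded_tuples (fun t => kron_lift K (x t)).
Proof.
move=> [B xB]; exists (\sum_i \sum_j `|K i j| * B) => t i.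
have B0 j : 0 <= B := le_trans (normr_ge0 _) (xB t j).
rewrite (bigD1 i)//= ffunE -[leLHS]addr0; apply: lerD.
  apply: (le_trans (ler_norm_sum _ _ _)); apply: ler_sum => j _.
  by rewrite normrZ ler_wpM2l.
by apply: sumr_ge0 => ? _; apply: sumr_ge0 => j _; rewrite mulr_ge0 ?(B0 j).
Qed.

Lemma bounded_tuplesD {n T} (x y : T -> H ^ n) :
  bounded_tuples x -> bounded_tuples y -> bounded_tuples (fun t => x t + y t).
Proof.
move=> [B xB] [B' yB]; exists (B + B') => t i.
by rewrite ffunE (le_trans (ler_normD _ _))// lerD.
Qed.

(** Weak compactness of bounded sets: the limits of the scalar products along
the ultrafilter define bounded linear functionals, one for each component, which
are represented by vectors. *)
Lemma ultra_wcvg {n T} (U : set_system T) (x : T -> H ^ n) :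
  UltraFilter U -> bounded_tuples x -> exists l, wcvg U x l.
Proof.
move=> UU [B xB].
suff wl i : exists l : H, forall y, inner (x t i) y @[t --> U] --> inner l y.
  have [l xl] := choice wl; exists [ffun i => l i] => y.
  rewrite /inner_prod; apply: cvg_big => [|i _]; first exact: add_continuous.
  by rewrite ffunE; exact: xl.
have lim_y y : exists a : R, inner (x t i) y @[t --> U] --> a.
  apply: (@ultra_bounded_cvg _ _ _ _ (B * `|y|)) => t.
  by apply: (le_trans (inner_le_norm _ _)); rewrite ler_wpM2r.
have [f fl] := choice lim_y.
have [||l fE] := @riesz_representation _ _ f B.
- move=> a y z; have fayz : inner (x t i) (a *: y + z) @[t --> U] --> a * f y + f z.
    under eq_fun do rewrite innerDr innerZr.
    by apply: cvgD; [apply: cvgMl_tmp|]; exact: fl.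
  exact: (cvg_unique _ (fl _) fayz).
- move=> y; have fy : `|inner (x t i) y| @[t --> U] --> `|f y|.
    exact: cvg_norm (fl y).
  rewrite -(cvg_lim (@norm_hausdorff _ _) fy).
  apply: limr_le; first exact: cvgP fy.
  apply: nearW => t; apply: (le_trans (inner_le_norm _ _)).
  by rewrite ler_wpM2r.
by exists l => y; rewrite -fE; exact: fl.
Qed.

(** Constant tuples are annihilated when the rows of [K] sum to zero. *)
Lemma kron_lift_cst0 {m n} (K : 'M[R]_(m, n)) (a : H) :
  K *m ones = 0 :> 'cV[R]_m -> kron_lift K [ffun=> a] = 0.
Proof.
move=> K1; apply/ffunP => i; rewrite !ffunE.
under eq_bigr do rewrite ffunE.
rewrite -scaler_suml.
have /= K1i := congr1 (fun B : 'cV[R]_m => B i 0) K1; rewrite !mxE in K1i.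
suff -> : \sum_j K i j = 0 by rewrite scale0r.
by rewrite -[RHS]K1i; apply: eq_bigr => j _; rewrite mxE mulr1.
Qed.

Lemma inner_prod_cst {n} (x : H ^ n) (a : H) :
  inner_prod x [ffun=> a] = inner (\sum_i x i) a.
Proof. by rewrite inner_suml; apply: eq_bigr => i _; rewrite ffunE. Qed.

Lemma inner_prod_kron_lift_cst {n} (K : 'M[R]_n) (a b : H) :
  inner_prod (kron_lift K [ffun=> a]) [ffun=> b] =
  (\sum_i \sum_j K i j) * inner a b.
Proof.
rewrite mulr_suml; apply: eq_bigr => i _.
rewrite !ffunE inner_suml mulr_suml; apply: eq_bigr => j _.
by rewrite ffunE innerZl.
Qed.

Lemma bounded_cst {n T} (c : H ^ n) : bounded_tuples (fun _ : T => c).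
Proof.
by exists (\sum_i `|c i|) => _ i; rewrite (bigD1 i)//= lerDl sumr_ge0.
Qed.

Lemma inner_prod_bounded_tuples {n T} (x : T -> H ^ n) (B : R) :
  (forall t, inner_prod (x t) (x t) <= B) -> bounded_tuples x.
Proof.
move=> xB; exists (Num.sqrt B) => t i.
apply: le_trans (ler_wsqrtr (le_trans (norm_le_inner_prod (x t) i) (xB t))).
by rewrite sqrtr_sqr normr_id.
Qed.

Lemma inner_prod_null_tuples {n T} (F : set_system T) {FF : Filter F} (x : T -> H ^ n) :
  inner_prod (x t) (x t) @[t --> F] --> (0 : R) -> null_tuples F x.
Proof.
move=> x0 i; apply/cvgr0Pnorm_lt => e e0.
have e20 : 0 < e ^+ 2 by rewrite exprn_gt0.
near=> t; rewrite -(@ltr_pXn2r _ 2) ?nnegrE ?(ltW e0)//.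
apply: (le_lt_trans (norm_le_inner_prod _ _)).
by near: t; exact: cvgr_lt x0 _ e20.
Unshelve. all: by end_near. Qed.

End tuples.

(** * Positive semidefinite matrices and their spectra *)

Section positive_semidefinite.
Context {R : realType}.

Lemma dotmxE {n} (x y : 'cV[R]_n) : (x^T *m y) 0 0 = \sum_i x i 0 * y i 0.
Proof. by rewrite mxE; apply: eq_bigr => i _; rewrite mxE. Qed.

Lemma dotmx_ge0 {n} (x : 'cV[R]_n) : 0 <= (x^T *m x) 0 0.
Proof. by rewrite dotmxE sumr_ge0// => i _; rewrite -expr2 sqr_ge0. Qed.

Lemma dotmx_eq0 {n} (x : 'cV[R]_n) : (x^T *m x) 0 0 = 0 -> x = 0.
Proof.
rewrite dotmxE => /eqP; rewrite psumr_eq0 => [|i _]; last by rewrite -expr2 sqr_ge0.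
move=> /allP x0; apply/colP => i; rewrite mxE.
by have := x0 i (mem_index_enum _); rewrite implyTb -expr2 sqrf_eq0 => /eqP.
Qed.

Lemma gram_ker {m n} (M : 'M[R]_(m, n)) (x : 'cV[R]_n) :
  (x^T *m (M^T *m M) *m x) 0 0 = 0 -> M *m x = 0.
Proof. by move=> Mx0; apply: dotmx_eq0; rewrite trmx_mul !mulmxA in Mx0 *. Qed.

Lemma quad_block_mx {n} (t a : R) (b y : 'cV[R]_n) (D : 'M[R]_n) :
  ((col_mx t%:M y)^T *m block_mx a%:M b^T b D *m col_mx t%:M y) 0 0 =
  t ^+ 2 * a + 2 * t * (b^T *m y) 0 0 + (y^T *m D *m y) 0 0.
Proof.
rewrite tr_col_mx mul_row_block mul_row_col !mulmxDl tr_scalar_mx.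
rewrite -!mulmxA !mul_scalar_mx !mulmxA.
have E : y^T *m b *m t%:M = t *: (b^T *m y).
  rewrite mul_mx_scalar; congr (_ *: _).
  by rewrite [LHS]mx11_scalar [RHS]mx11_scalar -[in LHS](trmxK b) -trmx_mul mxE.
rewrite E.
move: (b^T *m y) (y^T *m D *m y) => B C; rewrite !mxE eqxx mulr1n; ring.
Qed.

(** By induction on the dimension, with the Schur complement
[D - a^-1 *: (b *m b^T)] of the upper left entry [a]. If [a = 0] then [b = 0], and
the convention [0^-1 = 0] makes the same formulas valid. *)
Lemma cholesky {n} (Q : 'M[R]_n) : psd Q -> exists T : 'M[R]_n, Q = T^T *m T.
Proof.
elim: n Q => [|n IH] Q; first by exists 0; apply/matrixP => -[].
rewrite -[Q](@submxK _ 1 n 1 n); set D := drsubmx _; set b := dlsubmx _.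
set bt := ursubmx _; rewrite [ulsubmx _]mx11_scalar; set a := _ 0 0.
move=> [symQ posQ].
have [btE DS] : bt = b^T /\ D^T = D.
  move: symQ; rewrite /symmx/= (@tr_block_mx _ 1 n 1 n).
  by case/(@eq_block_mx _ 1 n 1 n).
rewrite btE in posQ *.
have quad t (y : 'cV[R]_n) :
    0 <= t ^+ 2 * a + 2 * t * (b^T *m y) 0 0 + (y^T *m D *m y) 0 0.
  by rewrite -quad_block_mx; exact: posQ.
have a0 : 0 <= a by have := quad 1 0; rewrite !mulmx0 mxE mulr0 !addr0 expr1n mul1r.
(* for [a = 0] the form is affine in [t], and bounded below only if constant *)
have ab : a = 0 -> b = 0.
  move=> aE; apply: dotmx_eq0; apply: contrapT => /eqP bb0.
  set c := (b^T *m b) 0 0 in bb0; set e := (b^T *m D *m b) 0 0.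
  have := quad (- (e + 1) / (2 * c)) b; rewrite aE mulr0 add0r -/c -/e.
  rewrite (_ : _ + _ = -1); last by field.
  by rewrite oppr_ge0 ler10.
have [|T TE] := IH (D - a^-1 *: (b *m b^T)).
  split; first by rewrite /symmx/= linearB/= linearZ/= trmx_mul trmxK DS.
  move=> y; have := quad (- (a^-1 * (b^T *m y) 0 0)) y.
  have -> : (y^T *m (D - a^-1 *: (b *m b^T)) *m y) 0 0 =
            (y^T *m D *m y) 0 0 - a^-1 * (b^T *m y) 0 0 ^+ 2.
    have yb : y^T *m b = b^T *m y.
      by rewrite [LHS]mx11_scalar [RHS]mx11_scalar -[in LHS](trmxK b) -trmx_mul mxE.
    have bb : y^T *m (b *m b^T) *m y = (b^T *m y) *m (b^T *m y).
      by rewrite !mulmxA yb.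
    rewrite mulmxBr mulmxBl -scalemxAr -scalemxAl bb.
    by move: (b^T *m y) (y^T *m D *m y) => B C; rewrite !mxE big_ord1.
  set be := (b^T *m y) 0 0; have [->|an0] := eqVneq a 0.
    by rewrite invr0 !(mul0r, oppr0, mulr0, add0r, addr0).
  rewrite (_ : _ + 2 * _ * _ = - (a^-1 * be ^+ 2)); last by field.
  by rewrite addrC.
pose s := Num.sqrt a.
exists (block_mx s%:M (s^-1 *: b^T) 0 T).
rewrite (@tr_block_mx _ 1 n 1 n) (@mulmx_block _ 1 n 1 n 1 n).
rewrite tr_scalar_mx; have bT : (s^-1 *: b^T)^T = s^-1 *: b.
  by apply/matrixP => i j; rewrite !mxE.
rewrite bT; have ss : s * s = a by rewrite -expr2 sqr_sqrtr.
have sb : (s / s) *: b = b.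
  have [/ab ->|an0] := eqVneq a 0; first by rewrite scaler0.
  by rewrite divff ?scale1r// sqrtr_eq0 -ltNge lt_neqAle eq_sym an0.
have -> : s%:M *m (s^-1 *: b^T) = b^T.
  by rewrite mul_scalar_mx scalerA -[in RHS]sb; apply/matrixP => i j; rewrite !mxE.
have -> : (s^-1 *: b) *m s%:M = b by rewrite mul_mx_scalar scalerA sb.
have -> : (s^-1 *: b) *m (s^-1 *: b^T) = a^-1 *: (b *m b^T).
  by rewrite -scalemxAl -scalemxAr scalerA -invfM ss.
by rewrite !trmx0 !mul0mx !mulmx0 !addr0 -scalar_mxM ss -TE addrC subrK.
Qed.

End positive_semidefinite.

Section spectrum.
Context {R : realType}.

(** The algebraic multiplicity of the eigenvalue zero is at least the geometric
one. With [r] the rank, Gaussian elimination [A = P *m pid_mx r *m Q] turns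
['X - A] into [P *m ('X *: G - pid_mx r) *m Q], whose middle factor has its last
[n - r] rows divisible by ['X]. *)
Lemma Xn_dvd_char_poly {F : fieldType} {n} (A : 'M[F]_n) :
  ('X^(n - \rank A) %| char_poly A)%R.
Proof.
set r := \rank A.
pose P := col_ebase A; pose Q := row_ebase A.
have PU : P \in unitmx := col_ebase_unit A.
have QU : Q \in unitmx := row_ebase_unit A.
pose G := invmx P *m invmx Q.
pose C m (B : 'M[F]_m) : 'M[{poly F}]_m := map_mx polyC B.
have -> : char_poly A =
    \det (C _ P) * \det ('X *: C _ G - C _ (pid_mx r)) * \det (C _ Q).
  rewrite -!det_mulmx /char_poly /char_poly_mx; congr (\det _).
  rewrite mulmxBr mulmxBl -scalemxAr -scalemxAl /C -!map_mxM /G.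
  rewrite mulmxA mulmxV// mul1mx mulVmx// map_mx1 scalemx1.
  by rewrite mulmx_ebase.
pose D : 'rV[{poly F}]_n := \row_i (if (i < r)%N then 1 else 'X).
pose G' : 'M[{poly F}]_n := \matrix_(i, j)
  (if (i < r)%N then ('X *: C _ G - C _ (pid_mx r)) i j else C _ G i j).
have -> : 'X *: C _ G - C _ (pid_mx r) = diag_mx D *m G'.
  apply/matrixP => i j; rewrite mul_diag_mx [RHS]mxE [D _ _]mxE [G' _ _]mxE.
  case: ltnP => ir; first by rewrite mul1r.
  by rewrite !mxE (ltnNge i) ir andbF subr0.
rewrite det_mulmx det_diag.
have -> : \prod_i D 0 i = 'X^(n - r).
  under eq_bigr do rewrite mxE.
  rewrite -(big_mkord xpredT (fun i => if (i < r)%N then 1 else 'X)).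
  rewrite (@big_cat_nat _ _ _ r)//= ?rank_leq_row//.
  rewrite big_nat big1 ?mul1r; last by move=> i /andP[_ ->].
  rewrite -prodr_const_nat big_nat [RHS]big_nat; apply: eq_bigr => i /andP[ri _].
  by rewrite ltnNge ri.
by rewrite -mulrA dvdp_mull// -mulrA dvdp_mulr.
Qed.

Lemma psd_root_char_poly {n} (W : 'M[R]_n) a :
  psd W -> root (char_poly W) a -> 0 <= a.
Proof.
move=> [_ posW]; rewrite -eigenvalue_root_char => /eigenvalueP[v vW v0].
have := posW v^T; rewrite trmxK vW -scalemxAl mxE.
have vv : 0 < (v *m v^T) 0 0.
  have := dotmx_ge0 v^T; rewrite trmxK le_eqVlt => /orP[/eqP e|//].
  have := @dotmx_eq0 _ _ v^T; rewrite trmxK -e => /(_ erefl) /(congr1 trmx).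
  by rewrite trmxK trmx0 => /eqP; rewrite (negbTE v0).
by rewrite pmulr_lge0.
Qed.

(** If the kernel of a positive semidefinite matrix has dimension at least two, then
its list of eigenvalues begins with two zeros. *)
Lemma psd_lambda12 {n} (W : 'M[R]_n) :
  psd W -> (\rank W + 2 <= n)%N -> lambda 1 W + lambda 2 W = 0.
Proof.
move=> psdW rkW; pose p := char_poly W.
have p0 : p != 0 by rewrite monic_neq0// char_poly_monic.
have mu2 : (2 <= mup 0 p)%N.
  rewrite mup_geq// subr0; apply: dvdp_trans (Xn_dvd_char_poly W).
  by rewrite dvdp_exp2l// leq_subRL ?rank_leq_row.
have rootsE x : (x \in rootsR p) = root p x.
  by rewrite -roots_on_rootsR// in_itv.
have r0 : 0 \in rootsR p.
  by rewrite rootsE; apply: contraLR mu2 => /mupNroot ->.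
have : sorted <%R (rootsR p) by exact: sorted_roots.
have : all (fun a => 0 <= a) (rootsR p).
  by apply/allP => a; rewrite rootsE => /psd_root_char_poly; exact.
rewrite /lambda /eigenvalues -/p.
case: (rootsR p) r0 => // a s; rewrite inE => /orP[/eqP <- _ _|as0 /= /andP[a0 _]].
  rewrite /=; set k := mup _ _; have : (1 < k)%N by exact: mu2.
  by case: k => [|[|k]]//= _; rewrite addr0.
move=> /(order_path_min lt_trans)/allP/(_ _ as0).
by rewrite ltNge a0.
Qed.

(** The constraint on the two smallest eigenvalues makes the kernel a line. *)
Lemma lambda12_ker {n} (W : 'M[R]_n) (y z : 'cV[R]_n) :
  psd W -> 0 < lambda 1 W + lambda 2 W -> z != 0 ->
  W *m z = 0 -> W *m y = 0 -> exists a, y = a *: z.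
Proof.
move=> psdW lam z0 Wz Wy.
have WT : W^T = W := psdW.1.
suff /sub_rVP[a ya] : (y^T <= z^T)%MS.
  by exists a; apply: trmx_inj; rewrite ya linearZ.
apply: contraLR lam => yz.
suff rkW : (\rank W + 2 <= n)%N by rewrite psd_lambda12// ltxx.
have zT0 : z^T != 0 by rewrite -(inj_eq trmx_inj) trmxK trmx0.
have : (\rank z^T < \rank (z^T + y^T)%MS)%N.
  by apply: rank_ltmx; rewrite ltmxE addsmxSl addsmx_sub submx_refl.
rewrite rank_rV zT0 => rk2.
have : (z^T + y^T <= kermx W)%MS.
  by rewrite addsmx_sub !sub_kermx -{1 2}WT -!trmx_mul Wz Wy trmx0 eqxx.
move=> /mxrankS; rewrite mxrank_ker => /(leq_trans rk2).
by rewrite leq_subRL ?rank_leq_row.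
Qed.

Lemma enormE {n} (x : 'cV[R]_n) : enorm x ^+ 2 = (x^T *m x) 0 0.
Proof.
rewrite sqr_sqrtr ?dotmxE; first by apply: eq_bigr => i _; rewrite expr2.
by apply: sumr_ge0 => i _; exact: sqr_ge0.
Qed.

Lemma enormZ {n} (a : R) (x : 'cV[R]_n) : enorm (a *: x) = `|a| * enorm x.
Proof.
rewrite /enorm -sqrtr_sqr -sqrtrM ?sqr_ge0// mulr_sumr; congr Num.sqrt.
by apply: eq_bigr => i _; rewrite mxE exprMn.
Qed.

Lemma spectral_norm_ub {m n} (K : 'M[R]_(m, n)) :
  has_ubound [set enorm (K *m x) | x in [set x : 'cV[R]_n | enorm x <= 1]].
Proof.
exists (Num.sqrt (\sum_i (\sum_j `|K i j|) ^+ 2)) => _ [y /= y1 <-].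
rewrite ler_sqrt; last by apply: sumr_ge0 => i _; exact: sqr_ge0.
apply: ler_sum => i _; rewrite -real_normK ?num_real//.
rewrite ler_pXn2r ?nnegrE ?sumr_ge0// mxE.
apply: (le_trans (ler_norm_sum _ _ _)); apply: ler_sum => j _.
rewrite normrM ler_piMr//; apply: le_trans y1.
rewrite -sqrtr_sqr ler_sqrt; last by apply: sumr_ge0 => ? _; exact: sqr_ge0.
by rewrite (bigD1 j)//= lerDl sumr_ge0// => ? _; exact: sqr_ge0.
Qed.

Lemma enorm0 {n} : enorm (0 : 'cV[R]_n) = 0.
Proof. by rewrite -(scale0r (0 : 'cV[R]_n)) enormZ normr0 mul0r. Qed.

Lemma spectral_norm_ge0 {m n} (K : 'M[R]_(m, n)) : 0 <= spectral_norm K.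
Proof.
apply: (ub_le_sup (spectral_norm_ub K)).
by exists 0; rewrite ?mulmx0/= enorm0.
Qed.

(** The supremum defining the spectral norm is a bound on the whole space. *)
Lemma enorm_mulmx_le {m n} (K : 'M[R]_(m, n)) (x : 'cV[R]_n) :
  enorm (K *m x) <= spectral_norm K * enorm x.
Proof.
have [x0|x0] := eqVneq (enorm x) 0.
  have -> : x = 0 by apply: dotmx_eq0; rewrite -enormE x0 expr0n.
  by rewrite mulmx0 !enorm0 mulr0.
have xgt0 : 0 < enorm x by rewrite lt_neqAle eq_sym x0 sqrtr_ge0.
rewrite -ler_pdivrMr// mulrC.
apply: (ub_le_sup (spectral_norm_ub K)); exists ((enorm x)^-1 *: x) => /=.
  by rewrite enormZ gtr0_norm ?invr_gt0// mulVf.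
by rewrite -scalemxAr enormZ gtr0_norm ?invr_gt0.
Qed.

(** The Loewner bound [(mu / |W|) W <= mu Id]; when the spectral norm is zero the
quotient is zero by convention and the bound is trivial. *)
Lemma spectral_norm_psd {n} (W : 'M[R]_n) (mu : R) : W^T = W -> 0 <= mu ->
  psd (mu%:M - (mu / spectral_norm W) *: W).
Proof.
move=> WT mu0; set s := spectral_norm W.
split; first by rewrite /symmx/= linearB/= linearZ/= tr_scalar_mx WT.
move=> x; rewrite mulmxBr mulmxBl mul_mx_scalar -!scalemxAl -scalemxAr -scalemxAl.
have xx := dotmx_ge0 x; set q := (x^T *m W *m x) 0 0; set d := (x^T *m x) 0 0 in xx.
rewrite (_ : _ 0 0 = mu * d - mu / s * q); last first.
  by rewrite /d /q; move: (x^T *m x) (x^T *m W *m x) => D Q; rewrite !mxE.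
have [->|s0] := eqVneq s 0; first by rewrite invr0 mulr0 mul0r subr0 mulr_ge0.
have sgt0 : 0 < s by rewrite lt_neqAle eq_sym s0 spectral_norm_ge0.
rewrite (_ : _ - _ = mu / s * (s * d - q)); last by field.
rewrite mulr_ge0 ?divr_ge0 ?(ltW sgt0)//.
(* [2 s x^T W x <= s^2 |x|^2 + |W x|^2 <= 2 s^2 |x|^2] *)
have Wx : ((W *m x)^T *m (W *m x)) 0 0 <= s ^+ 2 * d.
  rewrite /d -!enormE -exprMn ler_pXn2r ?nnegrE ?mulr_ge0 ?sqrtr_ge0 ?(ltW sgt0)//.
  exact: enorm_mulmx_le.
have := dotmx_ge0 (s *: x - W *m x).
have -> : (s *: x - W *m x)^T = s *: x^T - (W *m x)^T by rewrite linearB/= linearZ.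
rewrite mulmxBl !mulmxBr -!scalemxAl -!scalemxAr.
have -> : (W *m x)^T *m x = x^T *m W *m x by rewrite trmx_mul WT.
rewrite mulmxA -(pmulr_rge0 (s * d - q) sgt0); move: Wx; rewrite /d /q.
move: ((W *m x)^T *m (W *m x)) (x^T *m x) (x^T *m W *m x) => E D Q.
rewrite !mxE; move: (E _ _) (D _ _) (Q _ _) => e d' q'; nra.
Qed.

End spectrum.

(** * Monotone operators *)

Section operators.
Context {R : realType} {H : hilbertType R}.

(** A pair that is monotonically related to the whole graph belongs to it. *)
Lemma maximal_monotone_mem (A : H -> set H) x u : maximal_monotone A ->
  (forall y w, A y w -> 0 <= inner (x - y) (u - w)) -> A x u.
Proof.
move=> [monA maxA] xu.
apply: (maxA (fun y => A y `|` [set w | y = x /\ w = u])); last by right.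
- move=> y1 y2 w1 w2 [Aw1|[-> ->]] [Aw2|[-> ->]].
  + exact: monA.
  + have := xu _ _ Aw1; rewrite -(opprB y1) -(opprB w1) innerNl innerNr.
    by rewrite opprK.
  + exact: xu.
  + by rewrite subrr inner0l.
- by move=> y w Aw; left.
Qed.

Lemma product_maximal_mem {n} (A : 'I_n -> H -> set H) (x u : H ^ n) :
  (forall i, maximal_monotone (A i)) ->
  (forall y w, product_op A y w -> 0 <= inner_prod (x - y) (u - w)) ->
  product_op A x u.
Proof.
move=> maxA xu i; apply: contrapT => nAi.
suff /choice[yw ywP] : forall j, exists yw : H * H, [/\ A j yw.1 yw.2,
    inner (x j - yw.1) (u j - yw.2) <= 0 &
    ~ A j (x j) (u j) -> inner (x j - yw.1) (u j - yw.2) < 0].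
  have := xu [ffun j => (yw j).1] [ffun j => (yw j).2].
  have Ayw : product_op A [ffun j => (yw j).1] [ffun j => (yw j).2].
    by move=> j; rewrite !ffunE; have [] := ywP j.
  move=> /(_ Ayw); apply/negP; rewrite -ltNge /inner_prod (bigD1 i)//=.
  rewrite -[ltRHS]addr0; apply: ltr_leD.
    by rewrite !ffunE; have [_ _] := ywP i; exact.
  by apply: sumr_le0 => j _; rewrite !ffunE; have [] := ywP j.
move=> j; have [Aj|nAj] := pselect (A j (x j) (u j)).
  by exists (x j, u j); split => //=; rewrite subrr inner0l.
suff [y [w [Ayw neg]]] : exists y w, A j y w /\ inner (x j - y) (u j - w) < 0.
  by exists (y, w); split => //=; exact: ltW.
apply: contrapT => nex; apply: nAj; apply: maximal_monotone_mem => // y w Ayw.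
by rewrite leNgt; apply/negP => neg; apply: nex; exists y, w.
Qed.

Lemma product_monotone {n} (A : 'I_n -> H -> set H) (x y u v : H ^ n) :
  (forall i, maximal_monotone (A i)) ->
  product_op A x u -> product_op A y v -> 0 <= inner_prod (x - y) (u - v).
Proof.
move=> maxA Axu Ayv; apply: sumr_ge0 => i _.
by rewrite !ffunE; have [monA _] := maxA i; exact: monA.
Qed.

Lemma product_strongly_monotone {n} (A : 'I_n -> H -> set H) mu (x y u v : H ^ n) :
  (forall i, strongly_monotone mu (A i)) ->
  product_op A x u -> product_op A y v ->
  mu * inner_prod (x - y) (x - y) <= inner_prod (x - y) (u - v).
Proof.
move=> smA Axu Ayv; rewrite /inner_prod mulr_sumr; apply: ler_sum => i _.
rewrite !ffunE inner_norm; exact: smA.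
Qed.

Lemma resolvent_mem {V : zmodType} (T : V -> set V) w x :
  resolvent T w x -> T x (w - x).
Proof. by move=> [u Tu <-]; rewrite addrC addKr. Qed.

End operators.

(** * Fejer monotonicity and weak convergence *)

(** In this section [M^T *m M] is the matrix [W], and [T^T *m T] is a
factorization of [Z - W]; [N] inverts [M] modulo constant tuples, [P] being the
orthogonal projection onto the tuples of sum zero; [i0] is an index whose row in
[L] is zero off the diagonal, with diagonal entry less than one. The modulus [mu] may be zero, which covers plain
monotonicity, and [kappa] satisfies [kappa W <= mu Id], as witnessed by [T']. *)

Section algorithm.
Context {R : realType} {H : hilbertType R} {n d : nat}.
Variables (A : 'I_n -> H -> set H) (L : 'M[R]_n) (M : 'M[R]_(d, n)).
Variables (T T' : 'M[R]_n) (N : 'M[R]_(n, d)) (mu kappa : R) (i0 : 'I_n).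

Let P : 'M[R]_n := 1%:M - n%:R^-1 *: const_mx 1.

Hypothesis maxA : forall i, maximal_monotone (A i).
Hypothesis smA : forall i, strongly_monotone mu (A i).
Hypothesis ZE : 2%:M - L - L^T = M^T *m M + T^T *m T.
Hypothesis M1 : M *m ones = 0 :> 'cV[R]_d.
Hypothesis T1 : T *m ones = 0 :> 'cV[R]_n.
Hypothesis NM : N *m M = P.
Hypothesis L0 : forall j, j != i0 -> L i0 j = 0.
Hypothesis L01 : L i0 i0 < 1.
Hypothesis muE : mu%:M - kappa *: (M^T *m M) = T'^T *m T'.

(** The element of [A x] prescribed by the resolvent equation
[x = J_A (- M^T z + L x)]. *)
Definition op_value (z : H ^ d) (x : H ^ n) : H ^ n :=
  - kron_lift M^T z + kron_lift L x - x.

(** Stationary pairs of the iteration: [x] solves the resolvent equation for [z],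
and the update of [z] vanishes. *)
Definition fixed_pair (z : H ^ d) (x : H ^ n) :=
  product_op A x (op_value z x) /\ kron_lift M x = 0.

Lemma op_valueB z x z' x' : op_value z x - op_value z' x' = op_value (z - z') (x - x').
Proof.
rewrite /op_value !kron_liftB.
move: (kron_lift M^T z) (kron_lift M^T z') (kron_lift L x) (kron_lift L x').
by move=> a b c e; rewrite !opprD (addrACA (- a)) (addrACA (- a + c)).
Qed.

Lemma kron_lift_center (x : H ^ n) :
  kron_lift P x = x - [ffun=> n%:R^-1 *: \sum_i x i].
Proof.
rewrite /P kron_lift_addmx kron_lift_oppmx kron_lift_scalar_mx scale1r kron_lift_scalemx.
congr (_ - _); apply/ffunP => i; rewrite !ffunE; congr (_ *: _).
by apply: eq_bigr => j _; rewrite mxE scale1r.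
Qed.

(** A tuple is determined by its image under [M] and its mean. *)
Lemma consensus_split (x : H ^ n) :
  x = kron_lift N (kron_lift M x) + [ffun=> n%:R^-1 *: \sum_i x i].
Proof. by rewrite -kron_lift_mulmx NM kron_lift_center subrK. Qed.

Lemma kron_lift_T_factor (x : H ^ n) :
  kron_lift T x = kron_lift (T *m N) (kron_lift M x).
Proof.
by rewrite {1}(consensus_split x) kron_liftD (kron_lift_cst0 _ T1) addr0 -kron_lift_mulmx.
Qed.

(** Polarized form of [Z = M^T M + T^T T]. *)
Lemma inner_prod_coupling (x y : H ^ n) :
  2 * inner_prod x y - inner_prod (kron_lift L x) y
    - inner_prod (kron_lift L^T x) y =
  inner_prod (kron_lift M x) (kron_lift M y) +
  inner_prod (kron_lift T x) (kron_lift T y).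
Proof.
have -> : inner_prod (kron_lift M x) (kron_lift M y) +
          inner_prod (kron_lift T x) (kron_lift T y) =
          inner_prod y (kron_lift (2%:M - L - L^T) x).
  rewrite ZE kron_lift_addmx !kron_lift_mulmx inner_prodDr -!kron_lift_adjoint.
  by rewrite (inner_prodC (kron_lift M y)) (inner_prodC (kron_lift T y)).
rewrite !kron_lift_addmx !kron_lift_oppmx kron_lift_scalar_mx.
rewrite !inner_prodDr !inner_prodNr inner_prodZr.
by rewrite !(inner_prodC y).
Qed.

Lemma inner_prod_op_value z x : inner_prod x (op_value z x) =
  - inner_prod (kron_lift M x) z
  - 2^-1 * (inner_prod (kron_lift M x) (kron_lift M x) +
            inner_prod (kron_lift T x) (kron_lift T x)).
Proof.
rewrite -inner_prod_coupling /op_value !inner_prodDr !inner_prodNr -kron_lift_adjoint.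
rewrite (kron_lift_adjoint L^T) trmxK (inner_prodC (kron_lift L x)).
by field.
Qed.

(** Operator values at consensus sum to zero, because [M 1 = 0] and
[1^T Z 1 = 0]. *)
Lemma op_value_sum z (a : H) : \sum_i op_value z [ffun=> a] i = 0.
Proof.
apply: inner_inj => b; rewrite -inner_prod_cst inner0l /op_value !inner_prodDl !inner_prodNl.
rewrite kron_lift_adjoint trmxK (kron_lift_cst0 _ M1) inner_prod0r oppr0 add0r.
have := inner_prod_coupling [ffun=> a] [ffun=> b].
rewrite !(kron_lift_cst0 _ M1) !(kron_lift_cst0 _ T1) !inner_prod0l addr0.
have -> : inner_prod (kron_lift L^T [ffun=> a]) [ffun=> b] =
          inner_prod (kron_lift L [ffun=> a]) [ffun=> b].
  rewrite !inner_prod_kron_lift_cst exchange_big; congr (_ * _).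
  by apply: eq_bigr => i _; apply: eq_bigr => j _; rewrite mxE.
lra.
Qed.

(** The [x]-part of a stationary pair is a consensus tuple at a zero of the sum. *)
Lemma fixed_pair_zero z x : fixed_pair z x ->
  exists2 xs, x = [ffun=> xs] & sum_op A xs 0.
Proof.
move=> [Ax Mx]; have xE := consensus_split x.
rewrite Mx in xE.
have {}xE : x = [ffun=> n%:R^-1 *: \sum_i x i].
  by rewrite {1}xE kron_lift0 add0r.
set xs := _ *: _ in xE; exists xs => //.
exists (op_value z x); last by rewrite xE op_value_sum.
by move=> i /=; have := Ax i; rewrite {1}xE ffunE.
Qed.

(** Conversely a zero of the sum gives a stationary pair: [-M^T z] has to be a
prescribed tuple of sum zero, and such tuples are in the range of [M^T]. *)
Lemma exists_fixed_pair : (exists xs, sum_op A xs 0) ->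
  exists z x, fixed_pair z x.
Proof.
move=> [xs [u Au u0]]; pose x : H ^ n := [ffun=> xs].
pose w : H ^ n := [ffun i => u i] - op_value 0 x.
exists (- kron_lift N^T w), x; split; last exact: kron_lift_cst0.
suff -> : op_value (- kron_lift N^T w) x = [ffun i => u i].
  by move=> i; rewrite !ffunE; exact: Au.
have w0 : \sum_i w i = 0.
  under eq_bigr do rewrite 2!ffunE.
  rewrite big_split/= u0 add0r.
  under eq_bigr do rewrite ffunE.
  by rewrite sumrN op_value_sum oppr0.
have PT : P^T = P.
  by rewrite /P; apply/matrixP => i j; rewrite !mxE eq_sym.
have wE : kron_lift M^T (kron_lift N^T w) = w.
  rewrite -kron_lift_mulmx -trmx_mul NM PT kron_lift_center w0 scaler0.
  by apply/ffunP => i; rewrite !ffunE subr0.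
rewrite /op_value kron_liftN opprK wE /w /op_value.
by rewrite kron_lift0 oppr0 add0r -addrA subrK.
Qed.

(** Row [i0] of the resolvent equation involves no other component of [x], so
[x i0] is a Lipschitz function of [z]. This yields both the boundedness of the
iterates and the uniqueness of weak limits. *)
Lemma first_component z x z' x' :
  product_op A x (op_value z x) -> product_op A x' (op_value z' x') ->
  `|x i0 - x' i0| <= (1 - L i0 i0)^-1 * `|kron_lift M^T (z - z') i0|.
Proof.
move=> Ax Ax'.
have [monA _] := maxA i0; have := monA _ _ _ _ (Ax i0) (Ax' i0).
have -> : op_value z x i0 - op_value z' x' i0 = op_value (z - z') (x - x') i0.
  by rewrite -op_valueB !ffunE.
set e := x i0 - x' i0.
have -> : op_value (z - z') (x - x') i0 =
    - kron_lift M^T (z - z') i0 - (1 - L i0 i0) *: e.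
  rewrite /op_value; move: (kron_lift M^T _) => w; rewrite !ffunE (bigD1 i0)//= big1.
    by rewrite !ffunE -/e addr0 scalerBl scale1r; move: (e) => f; rewrite opprB addrA.
  by move=> j ji0; rewrite L0 ?scale0r.
move: (kron_lift _ _ i0) => w; have l0 : 0 < 1 - L i0 i0 by rewrite subr_gt0.
rewrite innerDr !innerNr innerZr inner_norm -opprD oppr_ge0 => ineq.
rewrite ler_pdivlMl//.
have [->|e0] := eqVneq `|e| 0; first by rewrite mulr0.
rewrite -(@ler_pM2r _ `|e|) ?lt_neqAle ?[0 == _]eq_sym ?e0 ?normr_ge0//.
have := inner_le_norm e w; rewrite ler_norml => /andP[? _]; nra.
Qed.

(** One step of the iteration compared with a stationary pair. Monotonicity gives [2 <M x, z - z'> <= - |M x|^2 - |T (x - x')|^2 - 2 mu |x - x'|^2], and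
[mu |x - x'|^2] bounds [kappa |M x|^2]. *)
Lemma fejer_step (gamma : R) z x z' x' : 0 < gamma ->
  product_op A x (op_value z x) -> fixed_pair z' x' ->
  let zz := z + gamma *: kron_lift M x in
  inner_prod (zz - z') (zz - z') <= inner_prod (z - z') (z - z') -
    gamma * (1 + 2 * kappa - gamma) *
      inner_prod (kron_lift M x) (kron_lift M x).
Proof.
move=> g0 Ax [Ax' Mx'] /=.
have Me : kron_lift M (x - x') = kron_lift M x by rewrite kron_liftB Mx' subr0.
have := product_strongly_monotone smA Ax Ax'.
rewrite op_valueB inner_prod_op_value Me.
have : 0 <= mu * inner_prod (x - x') (x - x') -
            kappa * inner_prod (kron_lift M x) (kron_lift M x).
  have := inner_prod_ge0 (kron_lift T' (x - x')).
  rewrite kron_lift_adjoint -kron_lift_mulmx -muE kron_lift_addmx.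
  rewrite kron_lift_oppmx kron_lift_scalar_mx kron_lift_scalemx kron_lift_mulmx.
  by rewrite inner_prodDr inner_prodNr !inner_prodZr -kron_lift_adjoint Me.
have := inner_prod_ge0 (kron_lift T (x - x')).
have -> : z + gamma *: kron_lift M x - z' = (z - z') + gamma *: kron_lift M x.
  by rewrite addrAC.
move: (z - z') (kron_lift M x) => z1 e.
rewrite (inner_prodDl z1) !(inner_prodDr z1) !inner_prodZl !inner_prodZr.
rewrite (inner_prodC z1 e).
move: (inner_prod e z1) (inner_prod e e) (inner_prod z1 z1) => a b c.
move: (inner_prod _ _) (inner_prod _ _) => t s t0 s0 st.
have : 0 <= gamma * (- (2 * kappa + 1) * b - 2 * a); last by lra.
by rewrite mulr_ge0 ?(ltW g0)//; lra.
Qed.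

Section convergence.
Variables (gamma : R) (z : nat -> H ^ d) (x : nat -> H ^ n).
Hypothesis g0 : 0 < gamma.
Hypothesis gk : gamma < 1 + 2 * kappa.
Hypothesis itM : iteration_M A L gamma M z x.

Let e k := kron_lift M (x k).

Lemma iter_graph k : product_op A (x k) (op_value (z k) (x k)).
Proof. by have [/resolvent_mem] := itM k. Qed.

Lemma iter_step k : z k.+1 = z k + gamma *: e k.
Proof. by have [] := itM k. Qed.

Lemma fejer_decr z' x' k : fixed_pair z' x' ->
  gamma * (1 + 2 * kappa - gamma) * inner_prod (e k) (e k) <=
  inner_prod (z k - z') (z k - z') - inner_prod (z k.+1 - z') (z k.+1 - z').
Proof.
by move=> fp; rewrite iter_step; have /= := fejer_step g0 (iter_graph k) fp; lra.
Qed.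

Lemma fejer_coef_gt0 : 0 < gamma * (1 + 2 * kappa - gamma).
Proof. by rewrite mulr_gt0 ?subr_gt0. Qed.

Lemma fejer_nonincreasing z' x' : fixed_pair z' x' ->
  nonincreasing_seq (fun k => inner_prod (z k - z') (z k - z')).
Proof.
move=> fp; apply/nonincreasing_seqP => k.
rewrite -subr_ge0; apply: le_trans (fejer_decr k fp).
by rewrite mulr_ge0 ?inner_prod_ge0// ltW ?fejer_coef_gt0.
Qed.

Lemma fejer_cvg z' x' : fixed_pair z' x' ->
  cvgn (fun k => inner_prod (z k - z') (z k - z')).
Proof.
move=> fp; apply: nonincreasing_is_cvgn; first exact: fejer_nonincreasing fp.
by exists 0 => _ [k _ <-]; exact: inner_prod_ge0.
Qed.

Lemma bounded_z z' x' : fixed_pair z' x' -> bounded_tuples z.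
Proof.
move=> fp; have bzz : bounded_tuples (fun k => z k - z').
  pose B := inner_prod (z 0%N - z') (z 0%N - z').
  apply: (@inner_prod_bounded_tuples _ _ _ _ _ B) => k.
  exact: (fejer_nonincreasing fp (leq0n k)).
have := bounded_tuplesD bzz (@bounded_cst _ _ _ nat z').
by under eq_fun do rewrite subrK.
Qed.

Lemma null_residual z' x' : fixed_pair z' x' -> null_tuples \oo e.
Proof.
move=> fp; apply: inner_prod_null_tuples.
have /cvg_ex[/= l al] := fejer_cvg fp.
set a := fun k => _ in al; set c := gamma * (1 + 2 * kappa - gamma).
have c0 : 0 < c by exact: fejer_coef_gt0.
apply: (@squeeze_cvgr _ _ _ _ (fun=> 0) (fun k => c^-1 * (a k - a k.+1))).
- apply: nearW => k; rewrite inner_prod_ge0/= ler_pdivlMl//; exact: fejer_decr fp.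
- exact: cvg_cst.
- rewrite -(mulr0 c^-1) -(subrr l); apply: cvgM; first exact: cvg_cst.
  by apply: cvgB => //; rewrite (cvg_shiftS a).
Qed.

(** [M x k] is proportional to the increment of [z]. *)
Lemma bounded_residual z' x' : fixed_pair z' x' -> bounded_tuples e.
Proof.
move=> fp; have [B zB] := bounded_z fp.
exists (gamma^-1 * (B + B)) => k i; rewrite ler_pdivlMl// -[X in X * _]gtr0_norm//.
rewrite -normrZ (_ : gamma *: e k i = z k.+1 i - z k i).
  by apply: (le_trans (ler_normB _ _)); rewrite lerD.
by rewrite iter_step !ffunE addrC addKr.
Qed.

Lemma bounded_x z' x' : fixed_pair z' x' -> bounded_tuples x.
Proof.
move=> fp; have bz := bounded_z fp.
have [B eB] := bounded_kron_lift N (bounded_residual fp).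
have bzz : bounded_tuples (fun k => z k - z').
  by apply: bounded_tuplesD => //; exact: bounded_cst.
have [B' zB] := bounded_kron_lift M^T bzz.
have l0 : 0 < 1 - L i0 i0 by rewrite subr_gt0.
exists (B + B + (`|x' i0| + (1 - L i0 i0)^-1 * B')) => k i.
have -> : x k i = kron_lift N (e k) i - kron_lift N (e k) i0 +
                  (x' i0 + (x k i0 - x' i0)).
  rewrite [x' i0 + _]addrC subrK.
  set w := kron_lift N (e k).
  have E : x k = w + [ffun=> n%:R^-1 *: \sum_i x k i] by exact: consensus_split.
  move: (n%:R^-1 *: _) E => av ->; rewrite !ffunE.
  by rewrite addrA subrK.
apply: (le_trans (ler_normD _ _)); apply: lerD.
  by apply: (le_trans (ler_normB _ _)); rewrite lerD.
apply: (le_trans (ler_normD _ _)); rewrite lerD//.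
apply: (le_trans (first_component (iter_graph k) fp.1)).
by rewrite ler_wpM2l// invr_ge0 ltW.
Qed.

(** The pairing of [x k] with its operator value tends to zero, although in
general neither factor is strongly convergent: it is a sum of pairings of bounded
sequences with linear images of the null sequence [M x k]. *)
Lemma pairing_cvg0 z' x' : fixed_pair z' x' ->
  inner_prod (x k) (op_value (z k) (x k)) @[k --> \oo] --> (0 : R).
Proof.
move=> fp; have e0 := null_residual fp; have be := bounded_residual fp.
have -> : (fun k => inner_prod (x k) (op_value (z k) (x k))) =
   (fun k => - inner_prod (e k) (z k) - 2^-1 * (inner_prod (e k) (e k) +
     inner_prod (kron_lift (T *m N) (e k)) (kron_lift (T *m N) (e k)))).
  by apply/funext => k; rewrite inner_prod_op_value kron_lift_T_factor.
have E : - (0 : R) - 2^-1 * (0 + 0) = 0 by rewrite addr0 mulr0 subr0 oppr0.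
rewrite -[X in _ --> X]E; apply: cvgB.
  apply: cvgN; apply: inner_prod_null_bounded => //.
  exact: bounded_z fp.
apply: cvgM; first exact: cvg_cst.
apply: cvgD; first exact: inner_prod_null_bounded.
apply: inner_prod_null_bounded; first exact: null_kron_lift.
exact: bounded_kron_lift.
Qed.

(** The graph of the product operator is closed along the iteration: in the
monotonicity inequalities against a fixed element of the graph, every term has a
limit, and maximality applies to the limiting inequalities. *)
Lemma weak_limit_fixed (U : set_system nat) zeta xi z' x' :
  UltraFilter U -> \oo `<=` U ->
  fixed_pair z' x' -> wcvg U z zeta -> wcvg U x xi -> fixed_pair zeta xi.
Proof.
move=> UU ooU fp zU xU.
have Mxi : kron_lift M xi = 0.
  apply: (wcvg_unique (wcvg_kron_lift (K := M) xU)).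
  by apply: null_wcvg => i V V0; apply: ooU; exact: null_residual fp i V V0.
have uU : wcvg U (fun k => op_value (z k) (x k)) (op_value zeta xi).
  apply: wcvgD; last exact: wcvgN.
  by apply: wcvgD; [apply: wcvgN|]; exact: wcvg_kron_lift.
split=> //; apply: product_maximal_mem => // y w Ayw.
have xu0 : inner_prod xi (op_value zeta xi) = 0.
  rewrite inner_prod_op_value kron_lift_T_factor Mxi kron_lift0.
  by rewrite !inner_prod0l addr0 mulr0 subr0 oppr0.
pose f k := inner_prod (x k) (op_value (z k) (x k)) - inner_prod (x k) w -
  (inner_prod (op_value (z k) (x k)) y - inner_prod y w).
have fl : f k @[k --> U] --> inner_prod (xi - y) (op_value zeta xi - w).
  have -> : inner_prod (xi - y) (op_value zeta xi - w) =
     0 - inner_prod xi w - (inner_prod (op_value zeta xi) y - inner_prod y w).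
    move: (op_value zeta xi) xu0 => u xu0.
    rewrite !(inner_prodDl, inner_prodNl) !(inner_prodDr, inner_prodNr) xu0.
    by rewrite (inner_prodC y u); ring.
  apply: cvgB.
    apply: cvgB; last exact: xU.
    by move=> V V0; apply: ooU; exact: pairing_cvg0 fp V V0.
  by apply: cvgB; [exact: uU | exact: cvg_cst].
rewrite -(cvg_lim (@norm_hausdorff _ _) fl); apply: limr_ge; first exact: cvgP fl.
apply: nearW => k; have := product_monotone maxA (iter_graph k) Ayw.
rewrite /f; move: (op_value (z k) (x k)) => u.
rewrite !(inner_prodDl, inner_prodNl) !(inner_prodDr, inner_prodNr).
by rewrite (inner_prodC y u); lra.
Qed.

(** Opial's argument with ultrafilters: all weak limits of [z] coincide because
the distances to the [z]-parts of stationary pairs converge, and then so do those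
of [x] by [first_component] and consensus. *)
Theorem iteration_M_cvg :
  (exists xs, sum_op A xs 0) -> cvg_to_common_zero A x.
Proof.
move=> /exists_fixed_pair[z' [x' fp]].
have weak_limit U : UltraFilter U -> \oo `<=` U -> exists zeta xi,
    [/\ wcvg U z zeta, wcvg U x xi & fixed_pair zeta xi].
  move=> UU ooU.
  have [zeta zU] := ultra_wcvg UU (bounded_z fp).
  have [xi xU] := ultra_wcvg UU (bounded_x fp).
  by exists zeta, xi; split => //; exact: (weak_limit_fixed UU ooU fp zU xU).
have [U0 [UU0 ooU0]] := @ultraFilterLemma nat \oo _.
have [zeta0 [xi0 [zU0 xU0 fp0]]] := weak_limit U0 UU0 ooU0.
have [xs xi0E zero_xs] := fixed_pair_zero fp0.
exists xs => // y; rewrite -xi0E; apply: cvg_ultrafilters => U UU ooU.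
have [zeta [xi [zU xU fpU]]] := weak_limit U UU ooU.
suff -> : xi0 = xi by exact: xU.
have zz : zeta0 = zeta.
  (* [|z k - zeta0|^2 - |z k - zeta|^2] converges, so that [<z k, zeta - zeta0>]
     has the same limit along both ultrafilters *)
  have : cvgn (fun k => inner_prod (z k) (zeta - zeta0)).
    pose a c k := inner_prod (z k - c) (z k - c).
    have -> : (fun k => inner_prod (z k) (zeta - zeta0)) = (fun k =>
        2^-1 * (a zeta0 k - a zeta k +
                (inner_prod zeta zeta - inner_prod zeta0 zeta0))).
      apply/funext => k; rewrite /a.
      rewrite !(inner_prodDl, inner_prodNl) !(inner_prodDr, inner_prodNr).
      by rewrite (inner_prodC zeta (z k)) (inner_prodC zeta0 (z k)); field.
    apply: is_cvgM; first exact: is_cvg_cst.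
    apply: is_cvgD; last exact: is_cvg_cst.
    by apply: is_cvgB; [exact: fejer_cvg fp0 | exact: fejer_cvg fpU].
  move=> /cvg_ex[/= l cl].
  have c0 : inner_prod (z k) (zeta - zeta0) @[k --> U0] --> l.
    by move=> V Vl; apply: ooU0; exact: cl.
  have c1 : inner_prod (z k) (zeta - zeta0) @[k --> U] --> l.
    by move=> V Vl; apply: ooU; exact: cl.
  have l0 := cvg_unique (@norm_hausdorff _ _) (zU0 _) c0.
  have l1 := cvg_unique (@norm_hausdorff _ _) (zU _) c1.
  apply/esym/eqP; rewrite -subr_eq0; apply/eqP; apply: inner_prod_eq0.
  by rewrite {1}inner_prodDl inner_prodNl l0 l1 subrr.
have : xi0 i0 = xi i0.
  apply/eqP; rewrite -subr_eq0 -normr_le0.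
  have := first_component fp0.1 fpU.1.
  by rewrite zz subrr kron_lift0 ffunE normr0 mulr0.
have [xs1 -> _] := fixed_pair_zero fpU.
by rewrite xi0E !ffunE => ->.
Qed.

End convergence.
End algorithm.

(** * From the solution of the matrix problem to the algorithm *)

(** The two iterations are related by [v = - M^T z]. *)
Lemma iteration_W_to_M {R : realType} {H : hilbertType R} {n d : nat}
    (A : 'I_n -> H -> set H) (L : 'M[R]_n) (gamma : R) (M : 'M[R]_(d, n))
    (v x : nat -> H ^ n) :
  range (kron_lift M^T) (v 0%N) -> iteration_W A L gamma (M^T *m M) v x ->
  exists z, iteration_M A L gamma M z x.
Proof.
move=> [a _ va] itW.
pose z k := - a + gamma *: \sum_(j < k) kron_lift M (x j).
have zS k : z k.+1 = z k + gamma *: kron_lift M (x k).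
  by rewrite /z big_ord_recr/= scalerDr addrA.
have vz k : v k = - kron_lift M^T (z k).
  elim: k => [|k IH]; first by rewrite /z big_ord0 scaler0 addr0 kron_liftN opprK.
  have [_ ->] := itW k; rewrite IH zS; move: (z k) => zk.
  by rewrite kron_liftD kron_liftZ kron_lift_mulmx opprD.
by exists z => k; split => //; rewrite -vz; have [] := itW k.
Qed.

(** If the kernel of [M] consists of constant vectors, then the row space of [M]
contains the orthogonal complement of the all-ones vector. *)
Lemma row_factor {R : realType} {n d : nat} (M : 'M[R]_(d, n)) :
  (0 < n)%N -> (forall y : 'cV[R]_n, M *m y = 0 -> exists a, y = a *: ones) ->
  exists N : 'M[R]_(n, d), N *m M = 1%:M - n%:R^-1 *: const_mx 1.
Proof.
move=> n0 kerM; set P := 1%:M - _.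
have P1 : P *m ones = 0 :> 'cV[R]_n.
  rewrite mulmxBl mul1mx -scalemxAl; apply/colP => i; rewrite !mxE.
  under eq_bigr do rewrite !mxE mulr1.
  rewrite sumr_const card_ord mulVf ?subrr//.
  by rewrite pnatr_eq0 -lt0n.
suff /submxP[N PN] : (P <= M)%MS by exists N.
rewrite submxE; apply/eqP/matrixP => i j; rewrite [RHS]mxE.
have -> : (P *m cokermx M) i j = col j (P *m cokermx M) i 0 by rewrite [RHS]mxE.
rewrite colE -mulmxA -colE.
have [|a ->] := kerM (col j (cokermx M)).
  by rewrite colE mulmxA mulmx_coker mul0mx.
by rewrite -scalemxAr P1 scaler0 mxE.
Qed.

Theorem theorem1 (R : realType) (H : hilbertType R)
  (n : nat) (hn : (2 <= n)%N)
  (A : 'I_n -> H -> set H)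
  (hA : forall i, maximal_monotone (A i))
  (hzero : exists x, sum_op A x 0)
  (phi : 'M[R]_n * 'M[R]_n -> \bar R)
  (hproper : proper_objective phi) (hlsc : lsc_objective phi)
  (C : set ('M[R]_n * 'M[R]_n)) (hC : C `<=` objective_domain)
  (c : R) (hc : 0 < c)
  (eps : R) (heps : 0 <= eps < 2)
  (W Z : 'M[R]_n) (hsol : solution phi hn c eps C W Z)
  (L : 'M[R]_n) (hL : is_trig_mx L) (hZ : Z = 2%:M - L - L^T)
  (d : nat) (M : 'M[R]_(d, n)) (hM : W = M^T *m M) :
  (forall gamma : R, 0 < gamma < 1 -> both_converge A L gamma W M) /\
  (forall mu : R, 0 < mu -> (forall i, strongly_monotone mu (A i)) ->
     forall gamma : R, 0 < gamma < 1 + 2 * mu / spectral_norm W ->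
       both_converge A L gamma W M).
Proof.
have [[W1 [lamW [psdZW [Z1 [diagZ [Z11 [_ [psdW symZ]]]]]]]] _] := hsol.
set i0 := Ordinal (ltnW hn) in diagZ Z11.
have [T ZWT] := cholesky psdZW.
have ZE : 2%:M - L - L^T = M^T *m M + T^T *m T by rewrite -hZ -hM -ZWT addrC subrK.
have M1 : M *m ones = 0 :> 'cV[R]_d.
  by apply: gram_ker; rewrite -hM -mulmxA W1 mulmx0 mxE.
have T1 : T *m ones = 0 :> 'cV[R]_n.
  by apply: gram_ker; rewrite -ZWT mulmxBr mulmxBl Z1 -mulmxA W1 mulmx0 subr0 mxE.
have ones0 : ones != 0 :> 'cV[R]_n.
  by apply/eqP => /colP/(_ i0)/eqP; rewrite !mxE oner_eq0.
have [|N NM] := @row_factor _ _ _ M (ltnW hn).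
  move=> y My; apply: (lambda12_ker psdW) => //; first exact: lt_le_trans lamW.
  by rewrite hM -mulmxA My mulmx0.
have L0 j : j != i0 -> L i0 j = 0.
  move=> ji0; apply: (is_trig_mxP hL); rewrite /= lt0n.
  by apply: contraNN ji0 => /eqP j0; apply/eqP/val_inj.
have L01 : L i0 i0 < 1.
  have : 2 - eps <= Z i0 i0 by have /andP[] := Z11.
  by rewrite hZ !mxE eqxx mulr1n; have /andP[_] := heps; lra.
(* [mu = kappa = 0] for monotone operators, [kappa = mu / |W|] in the strongly
   monotone case *)
have core mu kappa (T' : 'M[R]_n) gamma : (forall i, strongly_monotone mu (A i)) ->
    mu%:M - kappa *: (M^T *m M) = T'^T *m T' -> 0 < gamma ->
    gamma < 1 + 2 * kappa -> both_converge A L gamma W M.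
  move=> smA muE g0 gk.
  have cvgM z x : iteration_M A L gamma M z x -> cvg_to_common_zero A x.
    move=> itM.
    exact: (iteration_M_cvg hA smA ZE M1 T1 NM L0 L01 muE g0 gk itM hzero).
  split=> [v x v0|z x]; last exact: cvgM.
  by rewrite hM => /(iteration_W_to_M v0)[z]; exact: cvgM.
split=> [gamma /andP[g0 g1]|mu mu0 smA gamma /andP[g0 gk]].
  apply: (core 0 0 0) => //; last by rewrite mulr0 addr0.
    by move=> i x y u v Axu Ayv; rewrite mul0r; exact: (hA i).1.
  by rewrite scale0r subr0 mulmx0; apply/matrixP => i j; rewrite !mxE mul0rn.
have [T' muE] := cholesky (spectral_norm_psd psdW.1 (ltW mu0)).
apply: (core mu (mu / spectral_norm W) T') => //; first by rewrite -hM.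
by rewrite mulrA.
Qed.
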